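(* Let $\mu:A^C\to\mathbb{C}$ be a complex-analytic function from an open subset $A^C$ of $\mathbb{C}^4$. Suppose that $$\Bigl(\frac{\partial}{\partial\widetilde{q}_1}-\mu\frac{\partial}{\partial q_2}\Bigr)\mu=0,\qquad\Bigl(\frac{\partial}{\partial\widetilde{q}_2}+\mu\frac{\partial}{\partial q_1}\Bigr)\mu=0,$$ i.e., suppose that $\mu$ represents a complex-analytic foliation by null planes. Then $\mu$ is a complex-harmonic morphism.
   Context: On $\mathbb{C}^4=\{(x_0,x_1,x_2,x_3)\}$ with holomorphic metric $dx_0^2+dx_1^2+dx_2^2+dx_3^2$, the standard null coordinates are $q_1=x_0+ix_1$, $\widetilde{q}_1=x_0-ix_1$, $q_2=x_2+ix_3$, $\widetilde{q}_2=x_2-ix_3$. The function $\mu$ represents the distribution of null planes with basis $\{\partial/\partial\widetilde{q}_1-\mu\,\partial/\partial q_2,\ \partial/\partial\widetilde{q}_2+\mu\,\partial/\partial q_1\}$; the displayed equations are the condition that this distribution is integrable. A complex-harmonic morphism $\phi:A^C\to\mathbb{C}$ is a complex-analytic function satisfying $\sum_{i=0}^3\partial^2\phi/\partial x_i^2=0$ and $\sum_{i=0}^3(\partial\phi/\partial x_i)^2=0$ on $A^C$. *)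

(* Defs.v *)
From HB Require Import structures.
From mathcomp Require Import all_boot all_order all_algebra complex.
From mathcomp Require Import all_classical all_reals all_analysis.
From mathcomp Require Import ring.
From mathcomp Require summability.

Set Implicit Arguments.
Unset Strict Implicit.
Unset Printing Implicit Defensive.

Import Order.TTheory GRing.Theory Num.Theory.
Import numFieldNormedType.Exports.

Local Open Scope classical_set_scope.
Local Open Scope ring_scope.

(* The usual topology on R[i], given by the modulus. *)
HB.instance Definition _ (R : realType) := NormedModule.copy R[i] R[i]^o.

(* The definitions are generic in the scalars C : numClosedFieldType; the
   complex numbers are the case C = R[i] with R : realType. *)

(* The unordered sum of the family u is l: the net of its finite partial sums
   converges to l. For complex families this is absolute convergence. *)
Definition has_sum (I : choiceType) (C : numClosedFieldType) (u : I -> C)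
    (l : C) : Prop :=
  summability.partial_sum u @ summability.totally --> l.

Definition monomial (C : numClosedFieldType) (n : nat)
    (alpha : {ffun 'I_n -> nat}) (z : 'rV[C]_n) : C :=
  \prod_(i < n) z 0 i ^+ alpha i.

(* f is, near each point a of A, the sum of a convergent power series in the
   coordinates of z - a. Functions on A are restrictions of total functions;
   when A is open, the values of f outside A are irrelevant. *)
Definition complex_analytic (C : numClosedFieldType) (n : nat)
    (A : set 'rV[C]_n) (f : 'rV[C]_n -> C) : Prop :=
  forall a, A a -> exists c : {ffun 'I_n -> nat} -> C,
    \forall z \near a, has_sum (fun alpha => c alpha * monomial alpha (z - a)) (f z).

Definition partial (C : numClosedFieldType) (n : nat) (i : 'I_n)
    (f : 'rV[C]_n -> C) (x : 'rV[C]_n) : C :=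
  'D_(delta_mx 0 i) f x.

Definition complex_harmonic_morphism (C : numClosedFieldType)
    (A : set 'rV[C]_4) (phi : 'rV[C]_4 -> C) : Prop :=
  [/\ complex_analytic A phi,
      forall x, A x -> \sum_(i < 4) partial i (partial i phi) x = 0
    & forall x, A x -> \sum_(i < 4) partial i phi x ^+ 2 = 0].

(* The coordinates (q_1, q~_1, q_2, q~_2), numbered 0, 1, 2, 3. *)
Definition to_null (C : numClosedFieldType) (x : 'rV[C]_4) : 'rV[C]_4 :=
  \row_k [:: x 0 0 + 'i * x 0 1; x 0 0 - 'i * x 0 1;
             x 0 2 + 'i * x 0 3; x 0 2 - 'i * x 0 3]`_k.

Definition of_null (C : numClosedFieldType) (q : 'rV[C]_4) : 'rV[C]_4 :=
  \row_k [:: (q 0 0 + q 0 1) / 2; (q 0 0 - q 0 1) / (2 * 'i);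
             (q 0 2 + q 0 3) / 2; (q 0 2 - q 0 3) / (2 * 'i)]`_k.

Lemma to_nullK (C : numClosedFieldType) :
  cancel (@to_null C) (@of_null C).
Proof.
move=> x; have i0 := neq0Ci C; apply/rowP => k; rewrite !mxE /=.
case: k => [[|[|[|[|//]]]] lt4] /=.
- by rewrite (_ : Ordinal lt4 = 0); [field | apply/val_inj].
- by rewrite (_ : Ordinal lt4 = 1); [field | apply/val_inj].
- by rewrite (_ : Ordinal lt4 = 2); [field | apply/val_inj].
- by rewrite (_ : Ordinal lt4 = 3); [field | apply/val_inj].
Qed.

Lemma of_nullK (C : numClosedFieldType) :
  cancel (@of_null C) (@to_null C).
Proof.
move=> q; have i0 := neq0Ci C; apply/rowP => k; rewrite !mxE /=.
case: k => [[|[|[|[|//]]]] lt4] /=.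
- by rewrite (_ : Ordinal lt4 = 0); [field | apply/val_inj].
- by rewrite (_ : Ordinal lt4 = 1); [field | apply/val_inj].
- by rewrite (_ : Ordinal lt4 = 2); [field | apply/val_inj].
- by rewrite (_ : Ordinal lt4 = 3); [field | apply/val_inj].
Qed.

(* The k-th coordinate vector field of the null coordinate system, applied to
   f: the partial derivative of f written in null coordinates. *)
Definition dnull (C : numClosedFieldType) (k : 'I_4)
    (f : 'rV[C]_4 -> C) (x : 'rV[C]_4) : C :=
  partial k (f \o @of_null C) (to_null x).

Definition d_q1 (C : numClosedFieldType) := @dnull C 0.
Definition d_qt1 (C : numClosedFieldType) := @dnull C 1.
Definition d_q2 (C : numClosedFieldType) := @dnull C 2.
Definition d_qt2 (C : numClosedFieldType) := @dnull C 3.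

(* The basis of the null plane distribution represented by mu, as first-order
   differential operators. *)
Definition null_field1 (C : numClosedFieldType) (mu f : 'rV[C]_4 -> C)
    (x : 'rV[C]_4) : C :=
  d_qt1 f x - mu x * d_q2 f x.

Definition null_field2 (C : numClosedFieldType) (mu f : 'rV[C]_4 -> C)
    (x : 'rV[C]_4) : C :=
  d_qt2 f x + mu x * d_q1 f x.

(* Main.v *)
(* In null coordinates the gradient square and the Laplacian are
   4 (f_q1 f_q~1 + f_q2 f_q~2) and 4 (f_{q1 q~1} + f_{q2 q~2}). The equations say
   mu_q~1 = mu mu_q2 and mu_q~2 = - mu mu_q1, so the gradient square of mu
   vanishes; differentiating them along q1 and q2 and using the symmetry of second
   derivatives makes the Laplacian vanish.
   Second derivatives are obtained without differentiating the power series: the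
   part of degree at least 3 of the series at a is Lipschitz with constant
   O(rho^2) on the ball of radius rho. Applied at every point this gives first
   derivatives; applied at a it shows that the derivative at a + h differs from
   that of the quadratic Taylor polynomial by O(|h|^2). *)
Require Import Defs.
From mathcomp Require Import all_boot all_order all_algebra complex.
From mathcomp Require Import all_classical all_reals all_analysis.
From mathcomp Require Import finmap ring.
Import Order.TTheory GRing.Theory Num.Theory.
Import numFieldNormedType.Exports.
Local Open Scope classical_set_scope.
Local Open Scope ring_scope.

Set Implicit Arguments.
Unset Strict Implicit.
Unset Printing Implicit Defensive.

(** * Estimates for monomials and unordered sums *)

(** The bounds collected in [close] are stable under products, with the exponents adding up, because
    x1 y1 - x2 y2 = (x1 - x2) y1 + x2 (y1 - y2). The extra factor [rho] on the left replaces the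
    exponent m - 1 on the right, so that degree 0 needs no special case. *)
Lemma monomialB_le (C : numClosedFieldType) (n : nat)
    (alpha : {ffun 'I_n -> nat}) (h k : 'rV[C]_n) (rho d : C) :
    0 <= rho -> 0 <= d ->
    (forall i, `|h 0 i| <= rho) -> (forall i, `|k 0 i| <= rho) ->
    (forall i, `|h 0 i - k 0 i| <= d) ->
  `|monomial alpha h - monomial alpha k| * rho <=
    d * (\sum_i alpha i)%N%:R * rho ^+ (\sum_i alpha i)%N.
Proof.
move=> rho0 d0 hle kle hkle.
pose close (x y : C) m := [/\ `|x| <= rho ^+ m, `|y| <= rho ^+ m
  & `|x - y| * rho <= d * m%:R * rho ^+ m].
have close1 : close 1 1 0%N.
  by split; rewrite ?normr1 ?expr0 // subrr normr0 mul0r mulr0 mul0r.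
have closeM x1 x2 m1 y1 y2 m2 : close x1 x2 m1 -> close y1 y2 m2 ->
    close (x1 * y1) (x2 * y2) (m1 + m2)%N.
  move=> [x1le x2le xle] [y1le y2le yle]; split.
  - by rewrite exprD normrM ler_pM.
  - by rewrite exprD normrM ler_pM.
  have -> : x1 * y1 - x2 * y2 = (x1 - x2) * y1 + x2 * (y1 - y2) by ring.
  apply: (@le_trans _ _ ((`|x1 - x2| * rho) * `|y1| + `|x2| * (`|y1 - y2| * rho))).
    rewrite mulrAC mulrA -mulrDl ler_wpM2r // -!normrM.
    exact: ler_normD.
  rewrite natrD exprD.
  have -> : d * (m1%:R + m2%:R) * (rho ^+ m1 * rho ^+ m2) =
    d * m1%:R * rho ^+ m1 * rho ^+ m2 + rho ^+ m1 * (d * m2%:R * rho ^+ m2) by ring.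
  by apply: lerD; apply: ler_pM => //; rewrite mulr_ge0.
have closeX x y m : close x y 1%N -> close (x ^+ m) (y ^+ m) m.
  move=> cxy; elim: m => [|m IHm]; first by rewrite !expr0.
  by rewrite !exprS -[X in close _ _ X]add1n; apply: closeM.
suff [] : close (monomial alpha h) (monomial alpha k) (\sum_i alpha i)%N by [].
apply: (big_ind3 close) => // i _; apply: closeX; split; rewrite ?expr1 //.
by rewrite mulr1 ler_wpM2r.
Qed.

Lemma monomial_const (C : numClosedFieldType) (n : nat)
    (alpha : {ffun 'I_n -> nat}) (r : C) :
  monomial alpha (const_mx r) = r ^+ (\sum_i alpha i)%N.
Proof. by rewrite -prodrXr; apply: eq_bigr => i _; rewrite mxE. Qed.

Lemma partial_sumE (I : choiceType) (C : numClosedFieldType) (u : I -> C)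
    (J : {fset I}) :
  summability.partial_sum u J = \sum_(i <- J) u i.
Proof. by rewrite big_seq_fsetE. Qed.

Lemma has_sum_near (I : choiceType) (C : numClosedFieldType) (u : I -> C)
    (l e : C) :
  has_sum u l -> 0 < e ->
  exists J0 : {fset I}, forall J : {fset I}, (J0 `<=` J)%fset ->
    `|l - \sum_(i <- J) u i| <= e.
Proof.
move=> /(@cvgrPdist_le _ _ _ _ (@filter_filter _ _ (summability.totally_filter (I := I)))) ul e0.
have [J0 _ HJ0] := ul _ e0.
by exists J0 => J sub; rewrite -partial_sumE; apply: HJ0.
Qed.

(** Beyond a finite set [J0], adding one index changes a partial sum by [u i] while both partial
    sums stay within 1 of [l], whence the 2; the indices in [J0] are covered by the finite sum of
    their moduli. *)
Lemma has_sum_bounded (I : choiceType) (C : numClosedFieldType) (u : I -> C)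
    (l : C) :
  has_sum u l -> exists2 M : C, 0 <= M & forall i, `|u i| <= M.
Proof.
move=> /has_sum_near /(_ ltr01) [J0 HJ0].
exists (2 + \sum_(i <- J0) `|u i|); first by rewrite addr_ge0 // sumr_ge0.
move=> i; have [iJ0|iNJ0] := boolP (i \in J0).
  rewrite (big_fsetD1 i) //= addrCA lerDl addr_ge0 // sumr_ge0 //.
apply: (@le_trans _ _ 2); last by rewrite lerDl sumr_ge0.
have := HJ0 _ (fsubset_refl J0); have := HJ0 _ (fsubsetUr [fset i]%fset J0).
rewrite big_fsetU1 //= => le1 le2.
have -> : u i = (l - \sum_(i <- J0) u i) - (l - (u i + \sum_(i <- J0) u i)) by ring.
by rewrite (le_trans (ler_normB _ _)) // -[2]/(1 + 1) lerD.
Qed.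

(** A finite set of exponents lies in a box [0, N)^n. Over the box the sum factors into the n-th
    power of a truncated geometric series of ratio 1/2, which is at most 2. *)
Lemma sum_half_le (C : numClosedFieldType) (n : nat)
    (J : {fset {ffun 'I_n -> nat}}) :
  \sum_(alpha <- J) 2^-1 ^+ (\sum_i alpha i)%N <= 2 ^+ n :> C.
Proof.
pose N := (\max_(alpha <- J) \max_i alpha i).+1.
pose emb (b : {ffun 'I_n -> 'I_N}) : {ffun 'I_n -> nat} := [ffun i => val (b i)].
have emb_inj : injective emb.
  by move=> b b' /ffunP bb'; apply/ffunP => i; have := bb' i; rewrite !ffunE => /val_inj.
pose s := map emb (enum {: {ffun 'I_n -> 'I_N}}).
have Js : {subset J <= s}.
  move=> alpha aJ.
  have lt i : (alpha i < N)%N.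
    rewrite ltnS; apply: leq_trans (leq_bigmax i) _.
    exact: (leq_bigmax_seq (F := fun a : {ffun 'I_n -> nat} => \max_i a i)).
  apply/mapP; exists [ffun i => Ordinal (lt i)]; first by rewrite mem_enum.
  by apply/ffunP => i; rewrite !ffunE.
pose F (alpha : {ffun 'I_n -> nat}) : C := 2^-1 ^+ (\sum_i alpha i)%N.
have F0 alpha : 0 <= F alpha by rewrite exprn_ge0 // invr_ge0.
apply: (@le_trans _ _ (\sum_(alpha <- s) F alpha)).
  rewrite [leRHS](bigID (mem J)) /= -[X in _ <= X + _]big_filter.
  have perm : perm_eq [seq x <- s | x \in J] J.
    apply: uniq_perm; rewrite ?fset_uniq ?filter_uniq //.
      by rewrite map_inj_uniq ?enum_uniq.
    by move=> x; rewrite mem_filter; apply/andP/idP => [[]|xJ] //; split=> //; apply: Js.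
  by rewrite (perm_big _ perm) /= lerDl sumr_ge0.
rewrite big_map big_enum /=.
have -> : \sum_(b : {ffun 'I_n -> 'I_N}) F (emb b) =
    \sum_(b : {ffun 'I_n -> 'I_N}) \prod_i 2^-1 ^+ (b i).
  apply: eq_bigr => b _; rewrite /F -prodrXr; apply: eq_bigr => i _.
  by rewrite ffunE.
rewrite -(bigA_distr_bigA (fun (_ : 'I_n) (j : 'I_N) => 2^-1 ^+ j : C)) /=.
rewrite prodr_const card_ord; apply: lerXn2r => //; rewrite ?nnegrE //.
  by apply: sumr_ge0 => i _; rewrite exprn_ge0 // invr_ge0.
have half : 2^-1 - 1 = - 2^-1 :> C by field.
have := subrX1 (2^-1 : C) N; rewrite half mulNr => /eqP.
rewrite -eqr_oppLR opprB => /eqP /(congr1 (fun x => 2 * x)).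
rewrite mulrA divff ?pnatr_eq0 // mul1r => <-.
by rewrite -[leRHS]mulr1 ler_wpM2l // gerBl exprn_ge0 // invr_ge0.
Qed.

(** Three powers of [t] are kept and the others bounded by powers of 1/4; the factor [m] costs 2^m,
    and 2^m 4^(-(m-3)) = 64 2^(-m). What remains is summable over all exponents by [sum_half_le]. *)
Lemma natr_mul_exp_le (C : numClosedFieldType) (m : nat) (t : C) :
  (2 < m)%N -> 0 <= t -> t <= 4^-1 ->
  m%:R * t ^+ m <= 64 * t ^+ 3 * 2^-1 ^+ m.
Proof.
move=> m3 t0 t4.
have t4' : t ^+ (m - 3) <= 4^-1 ^+ (m - 3) by rewrite lerXn2r ?nnegrE ?invr_ge0.
have e4 : 4^-1 ^+ (m - 3) = 64 * 4^-1 ^+ m :> C.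
  rewrite -[in RHS](subnK m3) exprD mulrCA mulrC.
  have -> : 64 * 4^-1 ^+ 3 = 1 :> C by field.
  by rewrite mul1r.
have m2 : m%:R <= 2 ^+ m :> C by rewrite -natrX ler_nat ltnW // ltn_expl.
rewrite -[in t ^+ m](subnK m3) exprD.
apply: (@le_trans _ _ (2 ^+ m * ((64 * 4^-1 ^+ m) * t ^+ 3))).
  by rewrite -e4 ler_pM ?mulr_ge0 ?exprn_ge0 // ler_wpM2r ?exprn_ge0.
have -> : 2 ^+ m * (64 * 4^-1 ^+ m * t ^+ 3) = 64 * t ^+ 3 * (2 ^+ m * 4^-1 ^+ m) by ring.
by rewrite -exprMn (_ : 2 / 4 = 2^-1 :> C) //; field.
Qed.

(** * Polynomials of degree at most two *)

(** [B] need not be symmetric, so a product of two coordinates is given by a single elementary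
    matrix; the Hessian is then B + B^T. *)
Definition quad (C : numClosedFieldType) (n : nat) (c : C) (L : 'cV[C]_n)
    (B : 'M[C]_n) (h : 'rV[C]_n) : C :=
  c + (h *m L) 0 0 + (h *m B *m h^T) 0 0.

Definition is_quad (C : numClosedFieldType) (n : nat) (f : 'rV[C]_n -> C) :=
  exists c L B, f =1 quad c L B.

Lemma is_quad_lin (C : numClosedFieldType) (n : nat) (f g : 'rV[C]_n -> C)
    (a : C) :
  is_quad f -> is_quad g -> is_quad (fun h => a * f h + g h).
Proof.
move=> [c [L [B fE]]] [c' [L' [B' gE]]].
exists (a * c + c'), (a *: L + L'), (a *: B + B') => h.
rewrite fE gE /quad !(mulmxDr, mulmxDl) -!(scalemxAr, scalemxAl) !mxE; ring.
Qed.

Lemma is_quad0 (C : numClosedFieldType) (n : nat) :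
  is_quad (fun _ : 'rV[C]_n => 0).
Proof. by exists 0, 0, 0 => h; rewrite /quad !(mulmx0, mul0mx) !mxE !addr0. Qed.

Lemma is_quad1 (C : numClosedFieldType) (n : nat) :
  is_quad (fun _ : 'rV[C]_n => 1).
Proof. by exists 1, 0, 0 => h; rewrite /quad !(mulmx0, mul0mx) !mxE !addr0. Qed.

Lemma is_quad_coord (C : numClosedFieldType) (n : nat) (i : 'I_n) :
  is_quad (fun h : 'rV[C]_n => h 0 i).
Proof.
exists 0, (delta_mx i 0), 0 => h.
by rewrite /quad mulmx0 mul0mx -colE !mxE addr0 add0r.
Qed.

Lemma is_quad_coord2 (C : numClosedFieldType) (n : nat) (i j : 'I_n) :
  is_quad (fun h : 'rV[C]_n => h 0 i * h 0 j).
Proof.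
exists 0, 0, (delta_mx i j) => h.
rewrite /quad mulmx0 -(mul_delta_mx (0 : 'I_1)) mulmxA -mulmxA.
by rewrite -colE -rowE !mxE big_ord1 !mxE !add0r.
Qed.

Lemma monomial_deg0 (C : numClosedFieldType) (n : nat)
    (alpha : {ffun 'I_n -> nat}) (h : 'rV[C]_n) :
  (\sum_i alpha i)%N = 0%N -> monomial alpha h = 1.
Proof.
move=> /eqP; rewrite sum_nat_eq0 => /forallP a0.
by apply: big1 => i _; rewrite (eqP (a0 i)) expr0.
Qed.

Lemma monomial_degS (C : numClosedFieldType) (n m : nat)
    (alpha : {ffun 'I_n -> nat}) :
    (\sum_i alpha i)%N = m.+1 ->
  exists i (alpha' : {ffun 'I_n -> nat}), (\sum_i alpha' i)%N = m /\
    forall h : 'rV[C]_n, monomial alpha h = h 0 i * monomial alpha' h.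
Proof.
move=> am; have [i ai] : exists i, (0 < alpha i)%N.
  apply/existsP; rewrite -[X in is_true X]negbK negb_exists; apply/negP => /forallP a0.
  by move: am; rewrite big1 // => i _; apply/eqP; rewrite -leqn0 leqNgt.
exists i, [ffun j => alpha j - (j == i)]%N; split.
  rewrite (bigD1 i) //= ffunE eqxx; rewrite (bigD1 i) //= in am.
  apply: succn_inj; rewrite -am -addSn -subSn // subSS subn0; congr (_ + _)%N.
  by apply: eq_bigr => j ji; rewrite ffunE (negPf ji) subn0.
move=> h; rewrite /monomial (bigD1 i) //= [in RHS](bigD1 i) //= ffunE eqxx.
rewrite mulrA -exprS subn1 prednK //; congr (_ * _).
by apply: eq_bigr => j ji; rewrite ffunE (negPf ji) subn0.
Qed.

Lemma is_quad_monomial (C : numClosedFieldType) (n : nat)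
    (alpha : {ffun 'I_n -> nat}) :
  (\sum_i alpha i < 3)%N -> is_quad (@monomial C n alpha).
Proof.
case E : (\sum_i alpha i)%N => [|[|[|//]]] _.
- have [c [L [B H]]] := is_quad1 C n.
  by exists c, L, B => h; rewrite monomial_deg0.
- have [i [a [a0 aE]]] := monomial_degS C E.
  have [c [L [B H]]] := is_quad_coord C i.
  by exists c, L, B => h; rewrite aE monomial_deg0 // mulr1.
- have [i [a [a1 aE]]] := monomial_degS C E.
  have [j [b [b0 bE]]] := monomial_degS C a1.
  have [c [L [B H]]] := is_quad_coord2 C i j.
  by exists c, L, B => h; rewrite aE bE monomial_deg0 // mulr1.
Qed.

(** The box {0, 1, 2}^n will do. It makes the part of degree at most 2 the same in all sufficiently
    large partial sums. *)
Lemma finite_low_deg (n : nat) :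
  exists J : {fset {ffun 'I_n -> nat}}, forall alpha : {ffun 'I_n -> nat},
    (\sum_i alpha i < 3)%N -> alpha \in J.
Proof.
pose emb (b : {ffun 'I_n -> 'I_3}) : {ffun 'I_n -> nat} := [ffun i => val (b i)].
exists [fset alpha in map emb (enum {: {ffun 'I_n -> 'I_3}})]%fset => alpha a3.
have lt i : (alpha i < 3)%N by apply: leq_ltn_trans a3; rewrite (bigD1 i) //= leq_addr.
rewrite inE; apply/mapP; exists [ffun i => Ordinal (lt i)]; first by rewrite mem_enum.
by apply/ffunP => i; rewrite !ffunE.
Qed.

(** * The second-order Taylor estimate *)

Lemma mx_entry_le_norm (K : numFieldType) (m n : nat) (x : 'M[K]_(m, n)) i j :
  `|x i j| <= `|x|.
Proof.
apply/ler_addgt0Pr => e e0.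
have : ball (0 : 'M[K]_(m, n)) (`|x| + e) x.
  by rewrite mx_norm_ball /ball_ /= sub0r normrN ltrDl.
by case=> _ /(_ i j); rewrite /ball /= mxE sub0r normrN => /ltW.
Qed.

(* Bounding differences of the remainder, and not only its values, is what lets
   the estimate pass to the derivative of f at points near a. *)
Definition taylor2_at (C : numClosedFieldType) (n : nat) (f : 'rV[C]_n -> C)
    (a : 'rV[C]_n) (c : C) (L : 'cV[C]_n) (B : 'M[C]_n) (K r : C) :=
  forall rho (h k : 'rV[C]_n), rho <= r -> `|h| <= rho -> `|k| <= rho ->
    `|(f (a + h) - quad c L B h) - (f (a + k) - quad c L B k)| <=
      K * rho ^+ 2 * `|h - k|.

(** Convergence at one point with all coordinates equal to [r] bounds the coefficients. This makes
    the differences of the terms of degree at least 3 summable, uniformly over finite partial sums,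
    and the estimate passes to the limit. *)
Lemma analytic_taylor2 (C : numClosedFieldType) (n : nat)
    (A : set 'rV[C]_n) (f : 'rV[C]_n -> C) (a : 'rV[C]_n) :
    complex_analytic A f -> A a ->
  exists c L B (K r : C), [/\ 0 <= K, 0 < r & taylor2_at f a c L B K r].
Proof.
move=> fA /fA [u /nbhs_ballP [e /= e0 fe]].
have {fe} fe h : `|h| < e -> has_sum (fun alpha => u alpha * monomial alpha h) (f (a + h)).
  move=> he; have := fe (a + h); rewrite addrAC subrr add0r; apply.
  by rewrite mx_norm_ball /ball_ /= opprD addrA subrr add0r normrN.
pose r := e / 2.
have r0 : 0 < r by rewrite divr_gt0.
have re : r < e by rewrite ltr_pdivrMr // ltr_pMr // ltr1n.
(* Cauchy-type bound on the coefficients, read off at the point (r, ..., r), which lies in the ball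
   of convergence since r < e. *)
have [M M0 uM] : exists2 M : C, 0 <= M &
    forall alpha, `|u alpha| * r ^+ (\sum_i alpha i)%N <= M.
  have [|M M0 uM] := has_sum_bounded (fe (const_mx r) _); last first.
    exists M => // alpha; apply: le_trans (uM alpha).
    by rewrite monomial_const normrM normrX (gtr0_norm r0).
  suff : ball (0 : 'rV[C]_n) e (const_mx r).
    by rewrite mx_norm_ball /ball_ /= sub0r normrN.
  by split=> // i j; rewrite /ball /= !mxE sub0r normrN gtr0_norm.
have [J2 J2P] := finite_low_deg n.
pose low (alpha : {ffun 'I_n -> nat}) := (\sum_i alpha i < 3)%N.
have [c [L [B qE]]] : is_quad (fun h => \sum_(alpha <- J2 | low alpha) u alpha * monomial alpha h).
  elim: (enum_fset J2) => [|alpha s IHs].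
    have [c [L [B H]]] := is_quad0 C n; exists c, L, B => h.
    by rewrite big_nil.
  have [lowa|higha] := boolP (low alpha); last first.
    have [c [L [B H]]] := IHs; exists c, L, B => h.
    by rewrite big_cons (negPf higha).
  have [c [L [B H]]] := is_quad_lin (u alpha) (is_quad_monomial C lowa) IHs.
  by exists c, L, B => h; rewrite big_cons lowa.
(* 64 comes from [natr_mul_exp_le], 2^n from [sum_half_le] and M / r^3 from the coefficient bound;
   the radius r / 4 ensures rho / r <= 1/4. *)
exists c, L, B, (64 * 2 ^+ n * M / r ^+ 3), (r / 4); split.
- by rewrite divr_ge0 ?exprn_ge0 ?mulr_ge0 ?exprn_ge0 // ltW.
- by rewrite divr_gt0.
move=> rho h k rhor hrho krho.
have rho0 : 0 <= rho by apply: le_trans hrho.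
have rhoe : rho < e.
  apply: le_lt_trans re; apply: le_trans rhor _.
  by rewrite ler_pdivrMr // ler_peMr ?ler1n // ltW.
(* The case rho = 0 is set apart because the inequality is later multiplied by [rho] to match
   [monomialB_le]. *)
move: rho0; rewrite le_eqVlt => /predU1P[rho0|rho0].
  move: hrho krho; rewrite -rho0 !normr_le0 => /eqP -> /eqP ->.
  by rewrite !subrr !normr0 mulr0.
apply/ler_addgt0Pr => d d0.
have d20 : 0 < d / 2 by rewrite divr_gt0.
have [J1 J1P] := has_sum_near (fe h (le_lt_trans hrho rhoe)) d20.
have [J3 J3P] := has_sum_near (fe k (le_lt_trans krho rhoe)) d20.
(* [J1] and [J3] make the partial sums at [h] and [k] accurate to d / 2; [J2] makes their part of
   low degree exactly [quad c L B]. *)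
pose J := (J1 `|` J3 `|` J2)%fset.
have {J1P} hJ : `|f (a + h) - \sum_(alpha <- J) u alpha * monomial alpha h| <= d / 2.
  by apply: J1P; rewrite /J -fsetUA fsubsetUl.
have {J3P} kJ : `|f (a + k) - \sum_(alpha <- J) u alpha * monomial alpha k| <= d / 2.
  by apply: J3P; rewrite /J -fsetUA fsubsetU // fsubsetUl orbT.
have split x : \sum_(alpha <- J) u alpha * monomial alpha x =
    quad c L B x + \sum_(alpha <- J | ~~ low alpha) u alpha * monomial alpha x.
  rewrite (bigID low) /= -qE; congr (_ + _).
  rewrite -[LHS]big_filter -[RHS]big_filter.
  apply: perm_big; apply: uniq_perm; rewrite ?filter_uniq ?fset_uniq //.
  move=> alpha; rewrite !mem_filter /J; case la : (low alpha) => //=.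
  by rewrite !inE (J2P _ la) orbT.
move: hJ kJ; rewrite !split => hJ kJ.
set Sh := \sum_(alpha <- J | _) _ in hJ; set Sk := \sum_(alpha <- J | _) _ in kJ.
have -> : f (a + h) - quad c L B h - (f (a + k) - quad c L B k) =
  (Sh - Sk) + ((f (a + h) - (quad c L B h + Sh)) - (f (a + k) - (quad c L B k + Sk))).
  ring.
apply: le_trans (ler_normD _ _) _; apply: lerD; last first.
  by apply: le_trans (ler_normB _ _) _; rewrite [leRHS]splitr lerD.
rewrite -(ler_pM2r rho0) -sumrB.
(* Each term of degree m is bounded by a constant times 2^(-m), so the total does not depend on the
   choice of [J]. *)
apply: (@le_trans _ _ (\sum_(alpha <- J | ~~ low alpha)
   (64 * (rho / r) ^+ 3 * M * `|h - k|) * 2^-1 ^+ (\sum_i alpha i)%N)).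
  rewrite (le_trans (ler_wpM2r (ltW rho0) (ler_norm_sum _ _ _))) // mulr_suml.
  apply: ler_sum => alpha; rewrite /low -leqNgt => a3.
  set m := (\sum_i alpha i)%N in a3 *.
  rewrite -mulrBr normrM -mulrA.
  have le1 : `|monomial alpha h - monomial alpha k| * rho <= `|h - k| * m%:R * rho ^+ m.
    apply: monomialB_le => // [|i|i|i]; first exact: ltW.
    - exact: le_trans (mx_entry_le_norm _ _ _) hrho.
    - exact: le_trans (mx_entry_le_norm _ _ _) krho.
    - by have := mx_entry_le_norm (h - k) 0 i; rewrite !mxE.
  apply: le_trans (ler_wpM2l (normr_ge0 _) le1) _.
  have rhoE : rho = rho / r * r by rewrite divfK // gt_eqF.
  rewrite [in rho ^+ m]rhoE exprMn.
  have -> : `|u alpha| * (`|h - k| * m%:R * ((rho / r) ^+ m * r ^+ m)) =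
    (`|u alpha| * r ^+ m) * (m%:R * (rho / r) ^+ m) * `|h - k| by ring.
  have -> : 64 * (rho / r) ^+ 3 * M * `|h - k| * 2^-1 ^+ m =
    M * (64 * (rho / r) ^+ 3 * 2^-1 ^+ m) * `|h - k| by ring.
  apply: ler_wpM2r => //; apply: ler_pM => //.
  - by rewrite mulr_ge0 // exprn_ge0 // ltW.
  - by rewrite mulr_ge0 // exprn_ge0 // divr_ge0 // ltW.
  apply: natr_mul_exp_le => //; first by rewrite divr_ge0 // ltW.
  by rewrite ler_pdivrMr // mulrC.
rewrite -mulr_sumr.
have -> : 64 * 2 ^+ n * M / r ^+ 3 * rho ^+ 2 * `|h - k| * rho =
  64 * (rho / r) ^+ 3 * M * `|h - k| * 2 ^+ n.
  by field; rewrite gt_eqF.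
apply: ler_wpM2l.
  do 3 apply: mulr_ge0 => //.
  by apply: exprn_ge0; rewrite divr_ge0 // ltW.
apply: le_trans (sum_half_le C J); rewrite [leRHS](bigID low) /= lerDr.
by apply: sumr_ge0 => alpha _; rewrite exprn_ge0 // invr_ge0.
Qed.

(** * Derivatives from the Taylor estimate *)

(** The Hessian of [quad c L B] as a bilinear form. It is symmetric by construction; identifying it
    with the second derivatives of f yields their symmetry. *)
Definition polar (C : numClosedFieldType) (n : nat) (B : 'M[C]_n)
    (v w : 'rV[C]_n) : C :=
  (v *m B *m w^T) 0 0 + (w *m B *m v^T) 0 0.

Lemma quadD (C : numClosedFieldType) (n : nat) (c : C) (L : 'cV[C]_n)
    (B : 'M[C]_n) (h v : 'rV[C]_n) (t : C) :
  quad c L B (h + t *: v) = quad c L B h + t * ((v *m L) 0 0 + polar B h v) +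
    t ^+ 2 * (v *m B *m v^T) 0 0.
Proof.
rewrite /quad /polar linearD linearZ /= !(mulmxDr, mulmxDl).
rewrite -!(scalemxAr, scalemxAl) !mxE; ring.
Qed.

Lemma polarZl (C : numClosedFieldType) (n : nat) (B : 'M[C]_n)
    (v w : 'rV[C]_n) (t : C) :
  polar B (t *: v) w = t * polar B v w.
Proof.
by rewrite /polar linearZ /= -!(scalemxAr, scalemxAl) !mxE mulrDr.
Qed.

Lemma polarDl (C : numClosedFieldType) (n : nat) (B : 'M[C]_n)
    (u v w : 'rV[C]_n) :
  polar B (u + v) w = polar B u w + polar B v w.
Proof. by rewrite /polar linearD /= !(mulmxDr, mulmxDl) !mxE addrACA. Qed.

Lemma polarC (C : numClosedFieldType) (n : nat) (B : 'M[C]_n)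
    (v w : 'rV[C]_n) :
  polar B v w = polar B w v.
Proof. exact: addrC. Qed.

Lemma is_derive_sqr_error (C : numClosedFieldType) (n : nat)
    (f : 'rV[C]_n -> C) (a v : 'rV[C]_n) (l M : C) :
    0 <= M ->
    (\forall t \near (0 : C)^', `|f (t *: v + a) - f a - t * l| <= M * `|t| ^+ 2) ->
  is_derive a v f l.
Proof.
move=> M0 fM.
have cvgl : (fun t : C => t^-1 *: ((f \o shift a) (t *: v) - f a)) @ 0^' --> l.
  apply/cvgrPdist_le => e e0.
  (* M + 1 replaces M so that the division is safe when M = 0. *)
  have eM0 : 0 < e / (M + 1) by rewrite divr_gt0 // ltr_wpDl.
  have tM := dnbhs0_lt (V := C) eM0; have tn0 := nbhs_dnbhs_neq (0 : C).
  near=> t.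
  have t0 : t != 0 by near: t.
  have -> : l - t^-1 *: ((f \o shift a) (t *: v) - f a) =
      - (t^-1 * (f (t *: v + a) - f a - t * l)).
    by rewrite /= -[_ *: _]/(_ * _) [in RHS]mulrBr mulKf // opprB.
  rewrite normrN normrM normfV ler_pdivrMl ?normr_gt0 //.
  apply: (@le_trans _ _ (M * `|t| ^+ 2)); first by near: t.
  rewrite mulrC expr2 -mulrA ler_wpM2l //.
  apply: (@le_trans _ _ (`|t| * (M + 1))); first by rewrite ler_wpM2l // lerDl.
  rewrite -ler_pdivlMr ?ltr_wpDl //; apply: ltW; near: t; exact: tM.
apply: DeriveDef; first exact: (cvgP l).
exact: cvg_lim.
Unshelve. all: by end_near. Qed.

(** Compare h = t v with k = 0: the remainder is at most K |t v|^3 <= K |t v|^2 r, and the quadratic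
    term of [quad] is also of order t^2. *)
Lemma taylor2_is_derive (C : numClosedFieldType) (n : nat)
    (f : 'rV[C]_n -> C) (a v : 'rV[C]_n) c L B K r :
  0 <= K -> 0 < r -> taylor2_at f a c L B K r ->
  is_derive a v f ((v *m L) 0 0).
Proof.
move=> K0 r0 fT.
have Kv0 : 0 <= K * `|v| ^+ 2 * r by rewrite !mulr_ge0 ?exprn_ge0 // ltW.
apply: (@is_derive_sqr_error _ _ _ _ _ _
  (K * `|v| ^+ 2 * r + `|(v *m B *m v^T) 0 0|)).
  by rewrite addr_ge0.
have v1 : 0 < `|v| + 1 by rewrite ltr_wpDl.
have tr := dnbhs0_lt (V := C) (divr_gt0 r0 v1).
near=> t.
have tvr : `|t *: v| <= r.
  rewrite mx_normZ; apply: (@le_trans _ _ (`|t| * (`|v| + 1))).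
    by rewrite ler_wpM2l // lerDl.
  by rewrite -ler_pdivlMr //; apply: ltW; near: t; exact: tr.
have := fT _ (t *: v) 0 tvr (lexx _); rewrite normr0 => /(_ (normr_ge0 _)).
have := quadD c L B 0 v t; rewrite add0r => ->.
rewrite addr0 subr0 => gle.
have p0 : polar B 0 v = 0 by rewrite -(scale0r v) polarZl mul0r.
set g := (X in `|X| <= _) in gle.
have -> : f (t *: v + a) - f a - t * (v *m L) 0 0 =
    g + t ^+ 2 * (v *m B *m v^T) 0 0.
  by rewrite /g p0 [t *: v + a]addrC; ring.
apply: le_trans (ler_normD _ _) _; rewrite normrM normrX mulrDl.
apply: lerD; last by rewrite mulrC.
apply: le_trans gle _.
apply: (@le_trans _ _ (K * `|t *: v| ^+ 2 * r)).
  by rewrite ler_wpM2l // mulr_ge0 // exprn_ge0.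
rewrite mx_normZ exprMn.
by have -> : K * `|v| ^+ 2 * r * `|t| ^+ 2 = K * (`|t| ^+ 2 * `|v| ^+ 2) * r by ring.
Unshelve. all: by end_near. Qed.

(** At x = a + s w, compare h = s w with s w + t v and divide by t: the difference quotient of f
    along v is v L + s [polar B v w] + t v B v^T, up to K rho^2 |v| with rho = |s| (|w| + 1).
    Letting t tend to 0 gives the derivative at x with an error of order s^2. Derivability near a is
    what makes the quotient converge. *)
Lemma taylor2_is_derive2 (C : numClosedFieldType) (n : nat)
    (f : 'rV[C]_n -> C) (a v w : 'rV[C]_n) c L B K r :
  0 <= K -> 0 < r -> taylor2_at f a c L B K r ->
  (\forall x \near a, derivable f x v) ->
  is_derive a w (fun x => 'D_v f x) (polar B v w).
Proof.
move=> K0 r0 fT /nbhs_ballP[e /= e0 fd].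
have w1 : 0 < `|w| + 1 by rewrite ltr_wpDl.
have v1 : 0 < `|v| + 1 by rewrite ltr_wpDl.
apply: (@is_derive_sqr_error _ _ _ _ _ _ (K * (`|w| + 1) ^+ 2 * `|v|)).
  by rewrite mulr_ge0 // mulr_ge0 // exprn_ge0 // ltW.
have sr := dnbhs0_lt (V := C) (divr_gt0 r0 w1).
have se := dnbhs0_lt (V := C) (divr_gt0 e0 w1).
have sn0 := nbhs_dnbhs_neq (0 : C).
near=> s.
have s0 : s != 0 by near: s.
have sr1 : `|s| * (`|w| + 1) <= r.
  by rewrite -ler_pdivlMr //; apply: ltW; near: s; exact: sr.
have se1 : `|s| * (`|w| + 1) < e.
  by rewrite -ltr_pdivlMr //; near: s; exact: se.
have dfa := taylor2_is_derive v K0 r0 fT; rewrite derive_val.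
have swle : `|s *: w| <= `|s| * (`|w| + 1).
  by rewrite mx_normZ ler_wpM2l // lerDl.
have /fd : ball a e (s *: w + a).
  rewrite mx_norm_ball /ball_ /= opprD addrCA subrr addr0 normrN.
  exact: le_lt_trans se1.
set x := s *: w + a => /cvgrPdist_le dfx.
apply/ler_addgt0Pr => d d0.
have d20 : 0 < d / 2 by rewrite divr_gt0.
pose b := (v *m B *m v^T) 0 0.
have b1 : 0 < `|b| + 1 by rewrite ltr_wpDl.
have s1 : 0 < `|s| by rewrite normr_gt0.
have tb := dnbhs0_lt (V := C) (divr_gt0 d20 b1).
have ts := dnbhs0_lt (V := C) (divr_gt0 s1 v1).
have tn0 := nbhs_dnbhs_neq (0 : C).
have {dfx} dfx := dfx _ d20.
(* The first bound on t makes the term t b at most d / 2, the second keeps s w + t v in the ball of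
   radius rho, and the last compares the quotient with its limit. *)
suff [t [t0 {tb} tb {ts} ts tdf]] : exists t : C, [/\ t != 0,
    `|t| < d / 2 / (`|b| + 1), `|t| < `|s| / (`|v| + 1) &
    `|'D_v f x - t^-1 *: ((f \o shift x) (t *: v) - f x)| <= d / 2].
  pose h := s *: w.
  have hle : `|h + t *: v| <= `|s| * (`|w| + 1).
    apply: le_trans (ler_normD _ _) _; rewrite mx_normZ mulrDr mulr1 lerD2l.
    rewrite mx_normZ; apply: (@le_trans _ _ (`|t| * (`|v| + 1))).
      by rewrite ler_wpM2l // lerDl.
    by rewrite -ler_pdivlMr // ltW.
  have := fT _ _ _ sr1 hle swle; rewrite -/h quadD -/b.
  have -> : h + t *: v - h = t *: v by rewrite addrAC subrr add0r.
  set g := (X in `|X| <= _) => gle.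
  set D := _ *: _ in tdf.
  have DE : D = t^-1 * g + (v *m L) 0 0 + s * polar B v w + t * b.
    rewrite /D /= -[_ *: _]/(_ * _) /g /x -/h.
    rewrite [h + a]addrC [t *: v + _]addrC addrA [polar B h v]polarZl (polarC B w).
    by field.
  have -> : 'D_v f x - (v *m L) 0 0 - s * polar B v w =
     ('D_v f x - D) + t * b + t^-1 * g by rewrite DE; ring.
  rewrite [leRHS]addrC; apply: le_trans (ler_normD _ _) _; apply: lerD.
    rewrite [leRHS]splitr; apply: le_trans (ler_normD _ _) _; apply: lerD => //.
    rewrite normrM; apply: (@le_trans _ _ (`|t| * (`|b| + 1))).
      by rewrite ler_wpM2l // lerDl.
    by rewrite -ler_pdivlMr // ltW.
  rewrite normrM normfV ler_pdivrMl ?normr_gt0 //.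
  apply: le_trans gle _; rewrite mx_normZ le_eqVlt; apply/orP; left; apply/eqP.
  ring.
near (0 : C)^' => t; exists t; split; by near: t.
Unshelve. all: by end_near. Qed.

(** A single pair [L], [B] serves all directions at the point, so derivatives along coordinate and
    null vectors are related by linear algebra. *)
Lemma analytic_jet2 (C : numClosedFieldType) (n : nat) (A : set 'rV[C]_n)
    (f : 'rV[C]_n -> C) (a : 'rV[C]_n) :
    open A -> complex_analytic A f -> A a ->
  exists (L : 'cV[C]_n) (B : 'M[C]_n),
    (forall v, is_derive a v f ((v *m L) 0 0)) /\
    (forall v w, is_derive a w (fun x => 'D_v f x) (polar B v w)).
Proof.
move=> A_open fA Aa; have [c [L [B [K [r [K0 r0 fT]]]]]] := analytic_taylor2 fA Aa.
exists L, B; split=> [v|v w]; first exact: (taylor2_is_derive v K0 r0 fT).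
apply: (taylor2_is_derive2 w K0 r0 fT).
apply: filterS (open_nbhs_nbhs (conj A_open Aa)) => x Ax.
have [c' [L' [B' [K' [r' [K'0 r'0 fT']]]]]] := analytic_taylor2 fA Ax.
by have /@ex_derive := taylor2_is_derive v K'0 r'0 fT'.
Qed.

(** * Null coordinates *)

Lemma of_nullP (C : numClosedFieldType) (t : C) (p q : 'rV[C]_4) :
  of_null (t *: p + q) = t *: of_null p + of_null q.
Proof.
have i0 := neq0Ci C.
by apply/rowP => -[[|[|[|[|//]]]] lt4]; rewrite !mxE /=; field.
Qed.

(** Since [of_null] is linear, moving along a null coordinate means moving along a fixed vector of
    the original space. *)
Lemma dnullE (C : numClosedFieldType) (k : 'I_4) (f : 'rV[C]_4 -> C) :
  dnull k f = fun x => 'D_(of_null (delta_mx 0 k)) f x.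
Proof.
apply/funext => x; rewrite /dnull /partial /derive.
set F := fun t : C => _; set G := fun t : C => _.
suff -> : F = G by [].
by apply/funext => t; rewrite /F /G /= of_nullP to_nullK.
Qed.

(** The chain rule d/dx_0 = d/dq_1 + d/dq~_1 and d/dx_1 = i (d/dq_1 - d/dq~_1), in terms of
    vectors. *)
Lemma delta_null01 (C : numClosedFieldType) :
  (delta_mx 0 0 : 'rV[C]_4) = of_null (delta_mx 0 0) + of_null (delta_mx 0 1) /\
  (delta_mx 0 1 : 'rV[C]_4) =
    'i *: (of_null (delta_mx 0 0) - of_null (delta_mx 0 1)).
Proof.
have i0 := neq0Ci C.
by split; apply/rowP => -[[|[|[|[|//]]]] lt4]; rewrite !mxE /=; field.
Qed.

Lemma delta_null23 (C : numClosedFieldType) :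
  (delta_mx 0 2 : 'rV[C]_4) = of_null (delta_mx 0 2) + of_null (delta_mx 0 3) /\
  (delta_mx 0 3 : 'rV[C]_4) =
    'i *: (of_null (delta_mx 0 2) - of_null (delta_mx 0 3)).
Proof.
have i0 := neq0Ci C.
by split; apply/rowP => -[[|[|[|[|//]]]] lt4]; rewrite !mxE /=; field.
Qed.

(** As i^2 = -1, this is the polarization identity for (u + v, u + v) minus (u - v, u - v). It
    brings the Laplacian to null form, and [lin_null] does the same for the gradient square. *)
Lemma polar_null (C : numClosedFieldType) (n : nat) (B : 'M[C]_n)
    (u v : 'rV[C]_n) :
  polar B (u + v) (u + v) + polar B ('i *: (u - v)) ('i *: (u - v)) =
    4 * polar B u v.
Proof.
have polarZr t p q : polar B p (t *: q) = t * polar B p q.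
  by rewrite polarC polarZl polarC.
have polarDr p q r : polar B p (q + r) = polar B p q + polar B p r.
  by rewrite polarC polarDl !(polarC B p).
rewrite polarZl polarZr mulrA -expr2 sqrCi -(scaleN1r v).
rewrite !(polarDl, polarDr, polarZl, polarZr) (polarC B v u); ring.
Qed.

Lemma lin_null (C : numClosedFieldType) (n : nat) (L : 'cV[C]_n)
    (u v : 'rV[C]_n) :
  ((u + v) *m L) 0 0 ^+ 2 + (('i *: (u - v)) *m L) 0 0 ^+ 2 =
    4 * ((u *m L) 0 0 * (v *m L) 0 0).
Proof.
rewrite -scalemxAl mulmxBl mulmxDl !mxE [('i * _) ^+ 2]exprMn sqrCi; ring.
Qed.

Lemma sum_ord4 (V : nmodType) (F : 'I_4 -> V) :
  \sum_(i < 4) F i = F 0 + F 1 + (F 2 + F 3).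
Proof.
rewrite !big_ord_recr big_ord0 /= add0r -addrA.
by congr (F _ + F _ + (F _ + F _)); apply/val_inj.
Qed.

(** * From integrability to the two harmonic morphism equations *)

Lemma null_foliation_harmonic_morphism (C : numClosedFieldType)
    (A : set 'rV[C]_4) (mu : 'rV[C]_4 -> C) :
    open A -> complex_analytic A mu ->
    (forall x, A x -> null_field1 mu mu x = 0) ->
    (forall x, A x -> null_field2 mu mu x = 0) ->
  complex_harmonic_morphism A mu.
Proof.
move=> A_open mu_an eq1 eq2.
pose u k : 'rV[C]_4 := of_null (delta_mx 0 k).
have {}eq1 x : A x -> 'D_(u 1) mu x = (mu * (fun y => 'D_(u 2) mu y)) x.
  by move=> /eq1 /eqP; rewrite /null_field1 /d_qt1 /d_q2 !dnullE subr_eq0 => /eqP.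
have {}eq2 x : A x -> 'D_(u 3) mu x = - (mu * (fun y => 'D_(u 0) mu y)) x.
  by move=> /eq2 /eqP; rewrite /null_field2 /d_qt2 /d_q1 !dnullE addr_eq0 => /eqP.
have [e0 e1] : _ = u 0 + u 1 /\ _ = 'i *: (u 0 - u 1) := delta_null01 C.
have [e2 e3] : _ = u 2 + u 3 /\ _ = 'i *: (u 2 - u 3) := delta_null23 C.
split=> // x Ax; have [L [B [D1 D2]]] := analytic_jet2 A_open mu_an Ax.
  have near_x : \forall y \near x, A y := open_nbhs_nbhs (conj A_open Ax).
  (* The equations hold on a whole neighbourhood of x, so they may be differentiated there: the
     first along q_1, the second along q_2, each with the Leibniz rule. *)
  have E1 : polar B (u 1) (u 0) =
      mu x * polar B (u 2) (u 0) + (u 2 *m L) 0 0 * (u 0 *m L) 0 0.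
    have := D2 (u 1) (u 0) => /@derive_val <-.
    rewrite (near_eq_derive _ (filterS eq1 near_x)).
    have := is_deriveM (D1 (u 0)) (D2 (u 2) (u 0)) => /@derive_val ->.
    by have /@derive_val -> := D1 (u 2).
  have E2 : polar B (u 3) (u 2) =
      - (mu x * polar B (u 0) (u 2) + (u 0 *m L) 0 0 * (u 2 *m L) 0 0).
    have := D2 (u 3) (u 2) => /@derive_val <-.
    rewrite (near_eq_derive _ (filterS eq2 near_x)).
    have := is_deriveN (is_deriveM (D1 (u 2)) (D2 (u 0) (u 2))) => /@derive_val ->.
    by have /@derive_val -> := D1 (u 0).
  have -> : \sum_(i < 4) partial i (partial i mu) x =
      \sum_(i < 4) polar B (delta_mx 0 i) (delta_mx 0 i).
    by apply: eq_bigr => i _; have /@derive_val := D2 (delta_mx 0 i) (delta_mx 0 i).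
  (* In [E1] + [E2] the terms in mu cancel by symmetry of the mixed derivative in q_1 and q_2, and
     the products of first derivatives cancel as well. *)
  rewrite sum_ord4 e0 e1 e2 e3 !polar_null (polarC B (u 0)) E1.
  rewrite (polarC B (u 2) (u 3)) E2 (polarC B (u 2)); ring.
have -> : \sum_(i < 4) partial i mu x ^+ 2 =
    \sum_(i < 4) ((delta_mx 0 i : 'rV_4) *m L) 0 0 ^+ 2.
  by apply: eq_bigr => i _; have /@derive_val <- := D1 (delta_mx 0 i).
(* Substituting the equations leaves 4 (mu mu_q1 mu_q2 - mu mu_q2 mu_q1) = 0. *)
rewrite sum_ord4 e0 e1 e2 e3 !lin_null.
have /@derive_val := D1 (u 1); rewrite eq1 // => <-.
have /@derive_val := D1 (u 3); rewrite eq2 // => <-.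
rewrite !fctE.
have /@derive_val -> := D1 (u 0); have /@derive_val -> := D1 (u 2); ring.
Qed.

Theorem propositionS7p2 (R : realType) (A : set 'rV[R[i]]_4)
    (mu : 'rV[R[i]]_4 -> R[i])
    (A_open : open A)
    (mu_analytic : complex_analytic A mu)
    (mu_eq1 : forall x, A x -> null_field1 mu mu x = 0)
    (mu_eq2 : forall x, A x -> null_field2 mu mu x = 0) :
  complex_harmonic_morphism A mu.
Proof. exact: null_foliation_harmonic_morphism. Qed.
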